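(* Let $(X,\mathcal{E})$ be a connected coarse space and let $\leq$ be a linear order on $X$. The following statements are equivalent: (i) $(X,\mathcal{E},\leq)$ is linearly ordered, i.e. $\leq$ is compatible with the coarse structure $\mathcal{E}$; (ii) $\mathcal{E}$ has a base $\mathcal{E}'$ such that $E'[x]$ is convex in $(X,\leq)$ for all $x\in X$ and all $E'\in\mathcal{E}'$.
   Context: A coarse structure on a set $X$ is a family $\mathcal{E}$ of subsets of $X\times X$ (called entourages) such that: each $E\in\mathcal{E}$ contains the diagonal $\triangle_X=\{(x,x):x\in X\}$; if $E,E'\in\mathcal{E}$ then $E\circ E'\in\mathcal{E}$ and $E^{-1}\in\mathcal{E}$, where $E\circ E'=\{(x,y):\exists z\ ((x,z)\in E,\ (z,y)\in E')\}$ and $E^{-1}=\{(y,x):(x,y)\in E\}$; if $E\in\mathcal{E}$ and $\triangle_X\subseteq E'\subseteq E$ then $E'\in\mathcal{E}$. The pair $(X,\mathcal{E})$ is called a coarse space. For $x\in X$ and $E\in\mathcal{E}$, $E[x]=\{y\in X:(x,y)\in E\}$. A subfamily $\mathcal{E}'\subseteq\mathcal{E}$ is a base of $\mathcal{E}$ if each $E\in\mathcal{E}$ is contained in some $E'\in\mathcal{E}'$. The coarse space is connected if for any $x,y\in X$ there is $E\in\mathcal{E}$ with $y\in E[x]$. A linear order $\leq$ on $X$ is compatible with $\mathcal{E}$ if one of the following equivalent conditions holds: (1) for every $E\in\mathcal{E}$ there exists $F\in\mathcal{E}$ such that if $x<y$ and $y\in X\setminus F[x]$ then $x'<y$ for each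 $x'\in E[x]$; (2) for every $E\in\mathcal{E}$ there exists $H\in\mathcal{E}$ such that if $y<x$ and $y\in X\setminus H[x]$ then $y<x'$ for each $x'\in E[x]$; (3) for every $E\in\mathcal{E}$ there exists $K\in\mathcal{E}$ such that if $x<y$ and $y\in X\setminus K[x]$ then $x'<y'$ for all $x'\in E[x]$, $y'\in E[y]$. A (connected) coarse space endowed with a linear order compatible with its coarse structure is called linearly ordered. A subset $Y\subseteq X$ is convex in $(X,\leq)$ if $[a,b]\subseteq Y$ for all $a,b\in Y$, where $[a,b]=\{x\in X:a\leq x\leq b\}$. *)

(* Defs.v *)
From mathcomp Require Import all_boot all_order.
From mathcomp Require Import boolp classical_sets.

Set Implicit Arguments.
Unset Strict Implicit.
Unset Printing Implicit Defensive.

Import Order.TTheory.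
Local Open Scope order_scope.
Local Open Scope classical_set_scope.
Local Open Scope relation_scope.

(* The library composition [E' \; E] is [set (x, y) | exists z, E (x, z) and
   E' (z, y)]; it is what is written E o E' in coarse geometry. *)
Record coarse_structure (X : Type) (EE : set (set (X * X))) : Prop := {
  coarse_diagonal : forall E, EE E -> diagonal `<=` E;
  coarse_comp : forall E E', EE E -> EE E' -> EE (E' \; E);
  coarse_inv : forall E, EE E -> EE E^-1;
  coarse_subset : forall E E', EE E -> diagonal `<=` E' -> E' `<=` E -> EE E'
}.

(* [xsection E x] is E[x] = {y | (x, y) \in E}. *)
Definition coarse_connected (X : Type) (EE : set (set (X * X))) : Prop :=
  forall x y : X, exists2 E, EE E & xsection E x y.

Definition coarse_base (X : Type) (EE EE' : set (set (X * X))) : Prop :=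
  EE' `<=` EE /\ forall E, EE E -> exists2 E', EE' E' & E `<=` E'.

Definition order_convex (d : Order.disp_t) (X : orderType d) (Y : set X) :
    Prop :=
  forall a b : X, Y a -> Y b -> [set x | a <= x <= b] `<=` Y.

Definition compatible_up (d : Order.disp_t) (X : orderType d)
    (EE : set (set (X * X))) : Prop :=
  forall E, EE E -> exists2 F, EE F &
    forall x y : X, x < y -> ~ xsection F x y ->
    forall x', xsection E x x' -> x' < y.

Definition compatible_down (d : Order.disp_t) (X : orderType d)
    (EE : set (set (X * X))) : Prop :=
  forall E, EE E -> exists2 H, EE H &
    forall x y : X, y < x -> ~ xsection H x y ->
    forall x', xsection E x x' -> y < x'.

Definition compatible_both (d : Order.disp_t) (X : orderType d)
    (EE : set (set (X * X))) : Prop :=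
  forall E, EE E -> exists2 K, EE K &
    forall x y : X, x < y -> ~ xsection K x y ->
    forall x' y', xsection E x x' -> xsection E y y' -> x' < y'.

(* For a coarse structure the three conditions are equivalent: see
   [compatible_upP], [compatible_downP] and [compatible_bothP]. *)
Definition order_compatible (d : Order.disp_t) (X : orderType d)
    (EE : set (set (X * X))) : Prop :=
  [\/ compatible_up EE, compatible_down EE | compatible_both EE].

Lemma compatible_up_both (d : Order.disp_t) (X : orderType d)
    (EE : set (set (X * X))) :
  coarse_structure EE -> compatible_up EE -> compatible_both EE.
Proof.
move=> [dg cp iv _] up E EE_E; have [F EE_F FP] := up _ EE_E.
have [G EE_G GP] := up _ (iv _ EE_E).
have EE_M := cp _ _ EE_E (cp _ _ (iv _ EE_G) (iv _ EE_E)).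
exists (((E^-1 \; G^-1) \; E) \; F); first exact: cp EE_F EE_M.
move=> x y xy /xsectionP nK x' y' xx' yy'; rewrite ltNge; apply/negP => y'x'.
have x'y : x' < y.
  apply: FP xx' => // /xsectionP Fxy; apply: nK.
  by exists y => //; apply: (dg _ EE_M).
apply: nK; exists x; first exact: (dg _ EE_F).
exists x' => /=; first exact/xsectionP.
exists y' => /=; last exact/xsectionP.
apply: contrapT => nG; have y'x'lt : y' < x'.
  rewrite lt_neqAle y'x' andbT; apply/eqP => e.
  by apply: nG; apply: (dg _ EE_G).
have := GP _ _ y'x'lt (fun h => nG ((xsectionP _ _ _).1 h)) y.
have h : xsection E^-1 y' y by apply/xsectionP => /=; apply/xsectionP.
by move=> /(_ h); rewrite ltNge (ltW x'y).
Qed.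

Lemma compatible_down_both (d : Order.disp_t) (X : orderType d)
    (EE : set (set (X * X))) :
  coarse_structure EE -> compatible_down EE -> compatible_both EE.
Proof.
move=> [dg cp iv _] dn E EE_E; have [H EE_H HP] := dn _ EE_E.
have [G EE_G GP] := dn _ (iv _ EE_E).
have EE_M := cp _ _ EE_E (cp _ _ EE_G (iv _ EE_E)).
exists (((E^-1 \; G) \; E) \; H^-1); first exact: cp (iv _ EE_H) EE_M.
move=> x y xy /xsectionP nK x' y' xx' yy'; rewrite ltNge; apply/negP => y'x'.
have xy' : x < y'.
  apply: HP yy' => // /xsectionP Hyx; apply: nK.
  by exists y => //; apply: (dg _ EE_M).
apply: nK; exists x; first exact: (dg _ EE_H).
exists x' => /=; first exact/xsectionP.
exists y' => /=; last exact/xsectionP.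
apply: contrapT => nG; have y'x'lt : y' < x'.
  rewrite lt_neqAle y'x' andbT; apply/eqP => e.
  by apply: nG; apply: (dg _ EE_G).
have := GP _ _ y'x'lt (fun h => nG ((xsectionP _ _ _).1 h)) x.
have h : xsection E^-1 x' x by apply/xsectionP => /=; apply/xsectionP.
by move=> /(_ h); rewrite ltNge (ltW xy').
Qed.

Lemma compatible_both_up (d : Order.disp_t) (X : orderType d)
    (EE : set (set (X * X))) :
  coarse_structure EE -> compatible_both EE -> compatible_up EE.
Proof.
move=> [dg _ _ _] bt E EE_E; have [K EE_K KP] := bt _ EE_E.
exists K => // x y xy nK x' xx'; apply: (KP _ _ xy nK) => //.
by apply/xsectionP; apply: (dg _ EE_E).
Qed.

Lemma compatible_both_down (d : Order.disp_t) (X : orderType d)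
    (EE : set (set (X * X))) :
  coarse_structure EE -> compatible_both EE -> compatible_down EE.
Proof.
move=> [dg _ iv _] bt E EE_E; have [K EE_K KP] := bt _ EE_E.
exists K^-1; first exact: iv.
move=> x y yx /xsectionP nK x' xx'.
apply: (KP _ _ yx (fun h => nK ((xsectionP _ _ _).1 h))) => //.
by apply/xsectionP; apply: (dg _ EE_E).
Qed.

Lemma compatible_bothP (d : Order.disp_t) (X : orderType d)
    (EE : set (set (X * X))) :
  coarse_structure EE -> order_compatible EE <-> compatible_both EE.
Proof.
move=> cs; split; last by move=> ?; constructor 3.
by case=> //; [exact: compatible_up_both|exact: compatible_down_both].
Qed.

Lemma compatible_upP (d : Order.disp_t) (X : orderType d)
    (EE : set (set (X * X))) :
  coarse_structure EE -> order_compatible EE <-> compatible_up EE.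
Proof.
move=> cs; split; last by move=> ?; constructor 1.
by move=> /(compatible_bothP cs); exact: compatible_both_up.
Qed.

Lemma compatible_downP (d : Order.disp_t) (X : orderType d)
    (EE : set (set (X * X))) :
  coarse_structure EE -> order_compatible EE <-> compatible_down EE.
Proof.
move=> cs; split; last by move=> ?; constructor 2.
by move=> /(compatible_bothP cs); exact: compatible_both_down.
Qed.

(* Main.v *)
Require Import Defs.
From mathcomp Require Import all_boot all_order.
From mathcomp Require Import boolp classical_sets.

(** Compatibility says that the ball [E[x]] can neither reach nor pass a point
    [y <> x], unless [y] is close to [x] in a sense that depends on [E] only.

    If the balls of [E] are convex this is immediate: a point [y] that lies
    between [x] and some [x'] in [E[x]] is itself in [E[x]], as [x] and [x']
    are, so [E] itself serves as the entourage that measures closeness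
    ([compatible_up_of_convex_base]).

    Conversely, replace every ball [E[x]] by its convex hull.  A point [y] of
    the hull has points of [E[x]] on both sides (possibly [y] itself), so when
    [y <> x] the ball reaches or passes [y] coming from [x]; [compatible_up]
    (when [y] is above [x]) or [compatible_down] (when it is below) then puts
    [y] in a ball around [x] that depends on [E] only.  Hence the hull is still
    an entourage ([coarse_convex_hull]), and the entourages with convex balls
    form a base. *)

Set Implicit Arguments.
Unset Strict Implicit.
Unset Printing Implicit Defensive.

Import Order.TTheory.
Local Open Scope order_scope.
Local Open Scope classical_set_scope.
Local Open Scope relation_scope.

Definition convex_hull_entourage (d : Order.disp_t) (X : orderType d)
    (E : set (X * X)) : set (X * X) :=
  [set p | exists a b : X, [/\ E (p.1, a), E (p.1, b) & a <= p.2 <= b]].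

Lemma sub_convex_hull (d : Order.disp_t) (X : orderType d)
    (E : set (X * X)) : E `<=` convex_hull_entourage E.
Proof. by move=> [x y] Exy; exists y, y; rewrite lexx. Qed.

Lemma convex_hull_convex (d : Order.disp_t) (X : orderType d)
    (E : set (X * X)) (x : X) :
  order_convex (xsection (convex_hull_entourage E) x).
Proof.
move=> y z /xsectionP[a [_ [Ea _ /andP[ay _]]]].
move=> /xsectionP[_ [b [_ Eb /andP[_ zb]]]] t /andP[yt tz].
apply/xsectionP; exists a, b; split=> //.
by rewrite (le_trans ay yt) (le_trans tz zb).
Qed.

(** The hull is bounded by a composition of the two entourages that
    [compatible_up] and [compatible_down] attach to [E]: since both contain the
    diagonal, the composition contains their union. *)
Lemma coarse_convex_hull (d : Order.disp_t) (X : orderType d)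
    (EE : set (set (X * X))) (E : set (X * X)) :
  coarse_structure EE -> compatible_up EE -> compatible_down EE ->
  EE E -> EE (convex_hull_entourage E).
Proof.
move=> [dg cp _ sb] up down EE_E.
have [F EE_F FP] := up _ EE_E; have [H EE_H HP] := down _ EE_E.
apply: (sb _ _ (cp _ _ EE_F EE_H)).
  by move=> p /(dg _ EE_E); exact: sub_convex_hull.
move=> [x y] [a [b [/= Ea Eb /andP[ay yb]]]].
case: (ltgtP x y) => [xy|yx|<-].
- exists y; last exact: (dg _ EE_H).
  apply: contrapT => nF.
  have := FP _ _ xy (fun h => nF ((xsectionP _ _ _).1 h)) b.
  by move=> /(_ ((xsectionP _ _ _).2 Eb)); rewrite ltNge yb.
- exists x; first exact: (dg _ EE_F).
  apply: contrapT => nH.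
  have := HP _ _ yx (fun h => nH ((xsectionP _ _ _).1 h)) a.
  by move=> /(_ ((xsectionP _ _ _).2 Ea)); rewrite ltNge ay.
- by exists x; [exact: (dg _ EE_F)|exact: (dg _ EE_H)].
Qed.

Lemma compatible_up_of_convex_base (d : Order.disp_t) (X : orderType d)
    (EE EE' : set (set (X * X))) :
  coarse_structure EE -> coarse_base EE EE' ->
  (forall (x : X) (E' : set (X * X)),
     EE' E' -> order_convex (xsection E' x)) ->
  compatible_up EE.
Proof.
move=> [dg _ _ _] [sub base] conv E EE_E.
have [E' EE'_E' sEE'] := base _ EE_E; exists E'; first exact: sub.
move=> x y xy nE' x' /xsectionP Exx'; rewrite ltNge; apply/negP => yx'.
apply: nE'; apply: (conv x _ EE'_E' x x').
- by apply/xsectionP; apply: (dg _ (sub _ EE'_E')).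
- by apply/xsectionP; apply: sEE'.
- by rewrite /= (ltW xy).
Qed.

Theorem theorem1 (d : Order.disp_t) (X : orderType d)
    (EE : set (set (X * X)))
    (hcoarse : coarse_structure EE) (hconn : coarse_connected EE) :
  order_compatible EE <->
  (exists EE' : set (set (X * X)),
     coarse_base EE EE' /\
     forall (x : X) (E' : set (X * X)), EE' E' -> order_convex (xsection E' x)).
Proof.
split=> [comp|[EE' [base conv]]]; last first.
  exact/(compatible_upP hcoarse)/(compatible_up_of_convex_base hcoarse base conv).
exists [set E | EE E /\ forall x, order_convex (xsection E x)].
split; last by move=> x E' [].
split=> [E []//|E EE_E]; exists (convex_hull_entourage E).
  split; last exact: convex_hull_convex.
  apply: coarse_convex_hull => //; first exact/(compatible_upP hcoarse).
  exact/(compatible_downP hcoarse).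
exact: sub_convex_hull.
Qed.
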